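(* Let $A\in\mathbb{Z}^{m\times n}$ have full row rank and let $b\in\mathbb{Z}^m$. Let $u\in\mathbb{R}^n$, $u>0$, be such that every basic feasible solution of the system $Ax=b$, $x\ge 0$ satisfies $x\leq u$, and let $(v,w)\in\mathbb{R}^m\times\mathbb{R}^n_+$, $w\neq 0$, be a vector such that $(v^\top A+w^\top)\bar x< v^\top b+\frac{1}{2n}w^\top u$ for every $\bar x\in \{x\in\mathbb{R}^n : 0\leq x\leq u\}$. For $j=1,\ldots,n$, let $$u'_j:=\min\left\{u_j,\frac{\sum_{i=1}^n u_i w_i}{2n w_j}\right\}.$$ Then every basic feasible solution of $Ax=b$, $x\ge0$ satisfies $x\leq u'$. Furthermore, if $p\in\arg\max_{j=1,\ldots,n}\{u_j w_j\}$, then $u'_p\leq u_p/2$.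
   Context: Vector inequalities are componentwise; $\mathbb{R}^n_+$ is the set of componentwise nonnegative vectors. If $w_j=0$, the fraction in the definition of $u'_j$ is interpreted as $+\infty$, so $u'_j=u_j$. A basic feasible solution of $Ax=b$, $x\ge 0$ is a vertex of the polyhedron $\{x: Ax=b,\ x\ge 0\}$. *)

(* Defs.v *)
From mathcomp Require Import all_boot all_order all_algebra.
From mathcomp Require Import classical_sets reals.

Set Implicit Arguments.
Unset Strict Implicit.
Unset Printing Implicit Defensive.

Import Order.TTheory GRing.Theory Num.Theory.

Local Open Scope classical_set_scope.
Local Open Scope ring_scope.

Definition lev (R : realType) (n : nat) (x y : 'cV[R]_n) : Prop :=
  forall j, x j 0 <= y j 0.

Definition ltv (R : realType) (n : nat) (x y : 'cV[R]_n) : Prop :=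
  forall j, x j 0 < y j 0.

Notation "x <=v y" := (lev x y) (at level 70, no associativity).
Notation "x <v y" := (ltv x y) (at level 70, no associativity).

(* The product of a row and a column is a 1 x 1 matrix; this is its entry. *)
Definition dotv (R : realType) (n : nat) (r : 'rV[R]_n) (x : 'cV[R]_n) : R :=
  (r *m x) 0 0.

Notation "r *v x" := (dotv r x) (at level 40, no associativity).

Definition real_mx (R : realType) (m n : nat) (A : 'M[int]_(m, n)) :
  'M[R]_(m, n) := map_mx intr A.

Definition polyhedron (R : realType) (m n : nat) (A : 'M[R]_(m, n))
    (b : 'cV[R]_m) : set 'cV[R]_n :=
  [set x | A *m x = b /\ 0 <=v x].

(* F is the face of P cut out by some inequality c x <= d valid on P. *)
Definition is_face (R : realType) (n : nat) (P F : set 'cV[R]_n) : Prop :=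
  exists (c : 'rV[R]_n) (d : R),
    (forall x, P x -> c *v x <= d) /\ F = P `&` [set x | c *v x = d].

(* A vertex is a 0-dimensional face, i.e. a face reduced to one point. *)
Definition is_vertex (R : realType) (n : nat) (P : set 'cV[R]_n)
    (x : 'cV[R]_n) : Prop := is_face P [set x].

Definition basic_feasible (R : realType) (m n : nat) (A : 'M[R]_(m, n))
    (b : 'cV[R]_m) (x : 'cV[R]_n) : Prop := is_vertex (polyhedron A b) x.

(* When w_j = 0 the fraction in the minimum is read as +oo, leaving u_j. *)
Definition new_bound (R : realType) (n : nat) (u w : 'cV[R]_n) : 'cV[R]_n :=
  \col_j (if w j 0 == 0 then u j 0
          else Num.min (u j 0)
                 ((\sum_(i < n) u i 0 * w i 0) / (2 * n%:R * w j 0))).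

(* Main.v *)
Require Import Defs.
From mathcomp Require Import all_boot all_order all_algebra.
From mathcomp Require Import classical_sets reals.

Set Implicit Arguments.
Unset Strict Implicit.
Unset Printing Implicit Defensive.

Import Order.TTheory GRing.Theory Num.Theory.

Local Open Scope ring_scope.

(** A basic feasible [x] lies in the box, so the cut applies to it; since [A x = b], the [v] terms
    cancel and what remains is [w^T x < w^T u / (2n)]. All terms of [w^T x] are nonnegative, so each
    [w_j x_j] obeys the same bound, and dividing by [w_j > 0] bounds [x_j]. For the halving, a
    maximal [u_p w_p] is at least the average of the [u_i w_i], so [w^T u <= n u_p w_p]. *)

Lemma dotvE (R : realType) (n : nat) (r : 'rV[R]_n) (x : 'cV[R]_n) :
  r *v x = \sum_j r 0 j * x j 0.
Proof. by rewrite /dotv mxE. Qed.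

Lemma lev0P (R : realType) (n : nat) (x : 'cV[R]_n) :
  0 <=v x -> forall j, 0 <= x j 0.
Proof. by move=> x_ge0 j; have := x_ge0 j; rewrite mxE. Qed.

Lemma basic_feasibleW (R : realType) (m n : nat) (A : 'M[R]_(m, n))
    (b : 'cV[R]_m) (x : 'cV[R]_n) :
  basic_feasible A b x -> polyhedron A b x.
Proof.
case=> c [d [_ xE]]; have : [set x]%classic x by [].
by rewrite xE => -[].
Qed.

Theorem claim2 (R : realType) (m n : nat)
    (A : 'M[int]_(m, n)) (b : 'cV[int]_m)
    (A_full_row_rank : row_free (real_mx R A))
    (u : 'cV[R]_n) (u_gt0 : 0 <v u)
    (bfs_le_u : forall x : 'cV[R]_n,
       basic_feasible (real_mx R A) (real_mx R b) x -> x <=v u)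
    (v : 'cV[R]_m) (w : 'cV[R]_n) (w_ge0 : 0 <=v w) (w_neq0 : w <> 0)
    (vw_cut : forall x : 'cV[R]_n, 0 <=v x -> x <=v u ->
       (v^T *m real_mx R A + w^T) *v x
         < v^T *v real_mx R b + 1 / (2 * n%:R) * (w^T *v u)) :
  (forall x : 'cV[R]_n,
     basic_feasible (real_mx R A) (real_mx R b) x -> x <=v new_bound u w) /\
  (forall p : 'I_n, (forall j : 'I_n, u j 0 * w j 0 <= u p 0 * w p 0) ->
     new_bound u w p 0 <= u p 0 / 2).
Proof.
have w0 := lev0P w_ge0.
have u0 j : 0 < u j 0 by have := u_gt0 j; rewrite mxE.
have wuE : w^T *v u = \sum_(i < n) u i 0 * w i 0.
  by rewrite dotvE; apply: eq_bigr => i _; rewrite mxE mulrC.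
split=> [x x_bfs j | p p_max].
- have [Ax x_ge0] := basic_feasibleW x_bfs.
  have x0 := lev0P x_ge0; have x_le_u := bfs_le_u _ x_bfs.
  rewrite mxE; have [//|wj_neq0] := eqVneq (w j 0) 0.
  have wj_gt0 : 0 < w j 0 by rewrite lt_def wj_neq0 w0.
  rewrite le_min x_le_u /=.
  have := vw_cut _ x_ge0 x_le_u.
  (* [A x = b] turns [v^T A x] into [v^T b], which cancels on both sides. *)
  rewrite {1 2}/dotv mulmxDl -mulmxA Ax mxE ltrD2l -wuE => wx_lt.
  have wjxj : w j 0 * x j 0 <= (w^T *m x) 0 0.
    rewrite mxE (bigD1 j) //= mxE lerDl sumr_ge0 // => i _.
    by rewrite mxE mulr_ge0.
  rewrite invfM mulrA ler_pdivlMr // mulrC (le_trans wjxj) // ltW //.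
  by rewrite mulrC -div1r.
(* If [w_p = 0], maximality gives [u_j w_j <= 0] for every [j], and [u > 0] forces [w = 0]. Hence
   the fraction at [p] is finite. *)
- have wp_gt0 : 0 < w p 0.
    rewrite lt_def w0 andbT; apply/eqP => wp0; apply: w_neq0.
    apply/colP => j; rewrite mxE; apply/eqP; rewrite eq_le w0 andbT.
    by rewrite -(pmulr_rle0 _ (u0 j)) (le_trans (p_max j)) // wp0 mulr0.
  rewrite mxE gt_eqF // ge_min; apply/orP; right.
  have n_gt0 : 0 < n%:R :> R by rewrite ltr0n (leq_trans _ (ltn_ord p)).
  rewrite ler_pdivrMr ?mulr_gt0 //.
  (* The factor 2 cancels, leaving [n] copies of the largest term to compare with the sum
     termwise. *)
  have -> : u p 0 / 2 * (2 * n%:R * w p 0) = u p 0 * w p 0 *+ n.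
    by rewrite -[RHS]mulr_natr !mulrA divfK ?pnatr_eq0 // mulrAC.
  by rewrite -[X in _ *+ X]card_ord -sumr_const ler_sum.
Qed.
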